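(* Let $P$ be a probability measure on $\mathbb{R}^p$ that is absolutely continuous with respect to the Lebesgue measure, with density $f$, and let $\tau>0$. If $f$ has continuous first order partial derivatives, then, for all $j=1,\dots,p$, $\partial_j f_\tau$ is continuous in $S_\tau$ and, for all $x\in S$, $$\lim_{\tau\to 0^+}\partial_j f_\tau(x)=\partial_j f(x).$$ If also the second order partial derivatives of $f$ are continuous, then, for all $i,j=1,\dots,p$, $\partial_i\partial_j f_\tau$ is continuous in $S_\tau$ and, for all $x\in S$, $$\lim_{\tau\to 0^+}\partial_i\partial_j f_\tau(x)=\partial_i\partial_j f(x).$$
   Context: $p\ge 1$; $\|\cdot\|$ is the Euclidean norm on $\mathbb{R}^p$. For $x\in\mathbb{R}^p$ and $\tau\in[0,\infty]$, $$Z_\tau(x)=\{(x_1,x_2)\in\mathbb{R}^p\times\mathbb{R}^p:\ \max_{i=1,2}\|x-x_i\|\le\|x_1-x_2\|\le\tau\}.$$ The local lens depth is $LLD(x,\tau)=\int_{\mathbb{R}^p\times\mathbb{R}^p}\mathbf{I}((x_1,x_2)\in Z_\tau(x))\,dP(x_1)\,dP(x_2)$. $\Lambda_1$ is the Lebesgue measure of $Z_1(0)$ in $\mathbb{R}^p\times\mathbb{R}^p$. For $0<\tau<\infty$, $f_\tau(x)=\frac{1}{\tau^p\sqrt{\Lambda_1}}\sqrt{LLD(x,\tau)}$. Supports: $S=\{x\in\mathbb{R}^p:f(x)>0\}$ and $S_\tau=\{x\in\mathbb{R}^p:f_\tau(x)>0\}$. $\partial_j$ denotes the partial derivative with respect to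 the $j$-th component. *)

(* Defs.v *)
From HB Require Import structures.
From mathcomp Require Import all_boot all_order all_algebra.
From mathcomp Require Import all_classical all_reals all_analysis.

Set Implicit Arguments.
Unset Strict Implicit.
Unset Printing Implicit Defensive.

Import Order.TTheory GRing.Theory Num.Theory.
Import numFieldNormedType.Exports.

Local Open Scope classical_set_scope.
Local Open Scope ring_scope.

(* R^n is 'rV[R]_n.  Its measurable sets are generated by the coordinate
   functions, i.e. they form the n-fold product of the Borel sigma-algebra of
   R, which is the Borel sigma-algebra of R^n. *)
Definition rV_display : measure_display. Proof. exact. Qed.

Section measurable_rV.
Context {R : realType} {n : nat}.

Definition rV_coord (i : 'I_n) (x : 'rV[R]_n) : R := x 0 i.

HB.instance Definition _ := Pointed.on 'rV[R]_n.
HB.instance Definition _ := @isMeasurable.Build rV_display 'rV[R]_n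
  (g_sigma_preimage rV_coord) (@sigma_algebra0 _ _ _)
  (@sigma_algebraC _ _) (@sigma_algebra_bigcup _ _ _).

Lemma measurable_rV_coord (i : 'I_n) : measurable_fun setT (rV_coord i).
Proof.
move=> _ Y mY; apply: sub_sigma_algebra => /=.
by rewrite -bigcup_seq/=; exists i => /=; [rewrite mem_index_enum|exists Y].
Qed.

Lemma measurable_fun_rVP d (T : measurableType d) (f : T -> 'rV[R]_n) :
  (forall i, measurable_fun setT (rV_coord i \o f)) -> measurable_fun setT f.
Proof.
move=> mf _ A; rewrite setTI; move: A.
apply: (@smallest_sub _ (@sigma_algebra _ setT) _
  [set A | measurable (f @^-1` A)]).
  split => [|A /= mA|F /= mF].
  - by rewrite /= preimage_set0.
  - by rewrite setTD preimage_setC; exact: measurableC.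
  - by rewrite preimage_bigcup; exact: bigcupT_measurable.
rewrite -bigcup_seq => A /= [i _ [B mB <-]].
by rewrite /= setTI -comp_preimage -[X in measurable X]setTI; exact: mf.
Qed.

End measurable_rV.

Section lebesgue_rV.
Context {R : realType}.
Local Open Scope ereal_scope.

(* R x R^n -> R^(n+1); 1 + n and n.+1 are convertible *)
Definition rV_cons (n : nat) (z : measurableTypeR R * 'rV[R]_n) : 'rV[R]_n.+1 :=
  row_mx (const_mx z.1 : 'rV[R]_1) z.2.

Lemma rV_cons0 (n : nat) (z : measurableTypeR R * 'rV[R]_n) : rV_cons z 0%R ord0 = z.1 :> R.
Proof.
have -> : ord0 = lshift n (ord0 : 'I_1) :> 'I_n.+1 by exact/val_inj.
by rewrite [LHS](row_mxEl (const_mx z.1 : 'rV[R]_1)) mxE.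
Qed.

Lemma rV_consS (n : nat) (z : measurableTypeR R * 'rV[R]_n) (i : 'I_n) : rV_cons z 0%R (lift ord0 i) = z.2 0%R i :> R.
Proof.
have -> : lift ord0 i = rshift 1 i :> 'I_n.+1 by exact/val_inj.
by rewrite [LHS](row_mxEr (const_mx z.1 : 'rV[R]_1)).
Qed.

Lemma measurable_rV_cons (n : nat) : measurable_fun setT (@rV_cons n).
Proof.
apply: measurable_fun_rVP => i.
case: (unliftP ord0 i) => [j|] ->.
  rewrite (_ : _ \o _ = rV_coord j \o snd); last first.
    by apply/funext => z; rewrite /= /rV_coord rV_consS.
  by apply: measurableT_comp => //; exact: measurable_rV_coord.
rewrite (_ : _ \o _ = fst) //.
by apply/funext => z; rewrite /= /rV_coord rV_cons0.
Qed.

Section step.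
Context (n : nat) (m : {sigma_finite_measure set 'rV[R]_n -> \bar R}).

Definition lebesgue_rV_step : set 'rV[R]_n.+1 -> \bar R :=
  pushforward (@lebesgue_measure R \x m) (@rV_cons n).

Let pushm : {measure set 'rV[R]_n.+1 -> \bar R} :=
  measure_function_pushforward__canonical__measure_function_Measure
    (@lebesgue_measure R \x m) (@measurable_rV_cons n).

Let step0 : lebesgue_rV_step set0 = 0.
Proof. exact: (measure0 pushm). Qed.

Let step_ge0 A : 0 <= lebesgue_rV_step A.
Proof. exact: (measure_ge0 pushm). Qed.

Let step_sigma_additive : semi_sigma_additive lebesgue_rV_step.
Proof. exact: (@measure_semi_sigma_additive _ _ _ pushm). Qed.

HB.instance Definition _ := isMeasure.Build _ _ _ lebesgue_rV_step
  step0 step_ge0 step_sigma_additive.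

Lemma lebesgue_rV_step_sigma_finite : sigma_finite setT lebesgue_rV_step.
Proof.
have /sigma_finiteP[F [TF ndF Foo]] := sigma_finiteT (@lebesgue_measure R).
have /sigma_finiteP[G [TG ndG Goo]] := sigma_finiteT m.
pose g (x : 'rV[R]_n.+1) : measurableTypeR R * 'rV[R]_n :=
  (x 0%R ord0, \row_i x 0%R (lift ord0 i)).
have mg : measurable_fun setT g.
  apply: measurable_fun_pair; first exact: (measurable_rV_coord ord0).
  apply: measurable_fun_rVP => i.
  rewrite (_ : _ \o _ = rV_coord (lift ord0 i)).
    exact: measurable_rV_coord.
  by apply/funext => x; rewrite /rV_coord /= mxE.
have gK : cancel (@rV_cons n) g.
  move=> [a v]; rewrite /g rV_cons0 /=; congr (_, _).
  by apply/rowP => i; rewrite mxE rV_consS.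
exists (fun k => g @^-1` (F k `*` G k)).
  rewrite -preimage_bigcup; apply/seteqP; split => // x _ /=.
  have : [set: measurableTypeR R] (g x).1 by [].
  have : [set: 'rV[R]_n] (g x).2 by [].
  rewrite TF TG => -[k _ Gk] [l _ Fl]; exists (maxn k l) => //; split => /=.
    by move: Fl; exact/subsetPset/ndF/leq_maxr.
  by move: Gk; exact/subsetPset/ndG/leq_maxl.
move=> k; have [mF Fk] := Foo k; have [mG Gk] := Goo k; split.
  by rewrite -[X in measurable X]setTI; apply: mg => //; exact: measurableX.
rewrite /lebesgue_rV_step /pushforward -comp_preimage.
rewrite (_ : g \o _ = id); last by apply/funext => z; exact: gK.
by rewrite preimage_id product_measure1E// lte_mul_pinfty// ge0_fin_numE.
Qed.

HB.instance Definition _ := Measure_isSigmaFinite.Build _ _ _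
  lebesgue_rV_step lebesgue_rV_step_sigma_finite.

End step.

(* Lebesgue measure on R^n: the n-fold product of Lebesgue measure on R *)
Fixpoint lebesgue_rV (n : nat) : {sigma_finite_measure set 'rV[R]_n -> \bar R} :=
  match n with
  | 0 => @dirac _ 'rV[R]_0 0%R R
  | n'.+1 => lebesgue_rV_step (lebesgue_rV n')
  end.

Lemma lebesgue_rV_box (n : nat) (A : 'I_n -> set (measurableTypeR R)) :
  (forall i, measurable (A i)) ->
  lebesgue_rV n [set x | forall i, A i (x 0%R i)] =
  \prod_(i < n) lebesgue_measure (A i).
Proof.
elim: n A => [|n IH] A mA.
  by rewrite big_ord0 /= diracE mem_set// => -[].
have mB : measurable [set x : 'rV[R]_n | forall i, A (lift ord0 i) (x 0%R i)].
  rewrite (_ : [set _ | _] =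
      \big[setI/setT]_(i < n) (rV_coord i @^-1` A (lift ord0 i))).
    apply: bigsetI_measurable => i _.
    by rewrite -[X in measurable X]setTI; apply: measurable_rV_coord => //; exact: mA.
  rewrite -bigcap_seq; apply/seteqP; split => [x Ax i _|x Ax].
    exact: Ax.
  by move=> i; apply: (Ax i); rewrite /= mem_index_enum.
rewrite big_ord_recl -IH; last by move=> i; exact: mA.
rewrite /= /lebesgue_rV_step /pushforward -product_measure1E//.
congr (_ _); apply/seteqP; split => -[a v] /=.
  move=> Aav; split; first by have := Aav ord0; rewrite rV_cons0.
  by move=> i; have := Aav (lift ord0 i); rewrite rV_consS.
by move=> [Aa Av] i; case: (unliftP ord0 i) => [j|] ->;
  rewrite ?rV_cons0 ?rV_consS.
Qed.

End lebesgue_rV.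

Section local_lens_depth.
Context {R : realType} {p : nat}.
Implicit Types (x : 'rV[R]_p) (P : probability 'rV[R]_p R) (f : 'rV[R]_p -> R).

(* The library norm on 'rV[R]_p is the sup norm, hence this one. *)
Definition enorm x : R := Num.sqrt (\sum_(i < p) x 0 i ^+ 2).

Definition lens (tau : \bar R) x : set ('rV[R]_p * 'rV[R]_p) :=
  [set z | Num.max (enorm (x - z.1)) (enorm (x - z.2)) <= enorm (z.1 - z.2)
           /\ ((enorm (z.1 - z.2))%:E <= tau)%E].

Definition LLD P x (tau : \bar R) : R :=
  \int[(P \x P)%E]_z (\1_(lens tau x) z).

Definition Lambda1 : R :=
  fine ((lebesgue_rV p \x lebesgue_rV p)%E (lens 1%:E 0)).

Definition f_tau P (tau : R) x : R :=
  (tau ^+ p * Num.sqrt Lambda1)^-1 * Num.sqrt (LLD P x tau%:E).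

Definition is_density P f : Prop :=
  [/\ measurable_fun setT f, (forall x, 0 <= f x) &
      forall A : set 'rV[R]_p, measurable A ->
        P A = (\int[lebesgue_rV p]_(x in A) (f x)%:E)%E].

Definition pos_support f : set 'rV[R]_p := [set x | 0 < f x].

Definition e_ (j : 'I_p) : 'rV[R]_p := delta_mx 0 j.

Definition partial (j : 'I_p) f : 'rV[R]_p -> R := 'D_(e_ j) f.

(* 'D_v f x is a junk value when the limit does not exist, so existence is
   stated separately. *)
Definition continuous_partial_in (A : set 'rV[R]_p) (j : 'I_p) f : Prop :=
  (forall x, A x -> derivable f x (e_ j)) /\ {within A, continuous (partial j f)}.

End local_lens_depth.

(* Main.v *)
Require Import Defs.
From mathcomp Require Import all_boot all_order all_algebra.
From mathcomp Require Import all_classical all_reals all_analysis.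
From mathcomp Require Import measurable_realfun ring lra.
Import Order.TTheory GRing.Theory Num.Theory.
Import numFieldNormedType.Exports.
Local Open Scope classical_set_scope.
Local Open Scope ring_scope.

Set Implicit Arguments.
Unset Strict Implicit.
Unset Printing Implicit Defensive.

(** Substituting x_i = x + t y_i turns the lens Z_t(x) into the fixed bounded
set Z = Z_1(0), and the Jacobian t^(2p) is exactly what the normalisation of
f_t divides by ([LLD_rescaled], [f_tauE]).  Hence, for t > 0,

    f_t(x)^2 = 1/Lambda1 * integral over (y1, y2) in Z of f(x + t y1) f(x + t y2).

The right-hand side is the case g = h = f of the average
M(g,h)(t,x) = 1/Lambda1 * integral over Z of g(x + t y1) h(x + t y2)
([lens_mean]), which makes sense for every real t, in particular for t = 0,
where it is g(x) h(x) ([lens_mean0]).  Two facts about M give everything: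

- for continuous g and h, M(g,h) is jointly continuous in (t,x), because the
  integrand is continuous in (t,x) uniformly over a compact set containing Z
  ([continuous_lens_mean]);
- differentiation under the integral sign gives
  d_j M(g,h) = M(d_j g, h) + M(g, d_j h) for every fixed t
  ([is_derive_lens_mean]).

The function f itself is continuous because its partial derivatives are
([continuous_of_partials]).  So G = M(f,f) has first, respectively second,
partial derivatives in x that are again sums of functions M, hence jointly
continuous in (t,x).  Where G > 0 the chain rule expresses the derivatives of
f_t = sqrt(G(t,.)) as algebraic expressions in these sums, 1/sqrt(G) and
1/(G sqrt(G)); these are jointly continuous as well.  The set S_t is
{G(t,.) > 0}, which gives the continuity claims.  If f(x) > 0 then
G(0,x) = f(x)^2 > 0, so that the limit t -> 0+ is the value of the expression
at t = 0, and sqrt(G(0,.)) = f identifies it with the derivative of f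
([partial_small_scale]).

Only two changes of measure are needed for the first formula: integrals
against P are integrals against f ([product_density]), and the map
y |-> x + t y multiplies Lebesgue measure by t^p ([lebesgue_rV_affine]). *)

(** * Directional derivatives and partial derivatives *)

Section calculus.
Context {R : realType}.

Lemma rV_norm_le (p : nat) (y : 'rV[R]_p) (r : R) : 0 <= r ->
  (forall i, `|y 0 i| <= r) -> `|y| <= r.
Proof.
move=> r0 yr; rewrite [leLHS]/Num.norm /= mx_normrE; apply: bigmax_le => //.
by case=> i j _ /=; rewrite ord1.
Qed.

Lemma coord_le_norm (p : nat) (y : 'rV[R]_p) (i : 'I_p) : `|y 0 i| <= `|y|.
Proof.
rewrite [leRHS]/Num.norm /= mx_normrE.
exact: (@le_bigmax _ _ _ 0 (fun ij : 'I_1 * 'I_p => `|y ij.1 ij.2|) (0, i)).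
Qed.

Lemma is_derive_line (V : normedModType R) (g : V -> R) (x v : V) (t : R) :
  derivable g (x + t *: v) v ->
  is_derive t 1 (fun s : R => g (x + s *: v)) ('D_v g (x + t *: v)).
Proof.
move=> dg.
have E : (fun h : R => h^-1 *: (g (x + (h *: (1:R) + t) *: v) - g (x + t *: v)))
  = (fun h : R => h^-1 *: (g (h *: v + (x + t *: v)) - g (x + t *: v))).
  by apply/funext => h; congr (_ *: (g _ - _)); rewrite [h *: 1]mulr1 scalerDl addrCA.
by split; rewrite /derivable /derive /= E.
Qed.

(** The mean value theorem on the segment from x to x + s v; the intermediate
point is only located by |t| <= |s|, so that s may have either sign. *)
Lemma mean_value_dir (V : normedModType R) (g : V -> R) (x v : V) (s : R) :
  (forall t : R, derivable g (x + t *: v) v) ->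
  exists2 t : R, `|t| <= `|s| & g (x + s *: v) - g x = s * 'D_v g (x + t *: v).
Proof.
move=> dg; pose phi (t : R) := g (x + t *: v).
have dphi (t : R) : is_derive t 1 phi ('D_v g (x + t *: v)) by exact: is_derive_line.
have cphi (a b : R) : {within `[a, b], continuous phi}.
  apply: continuous_subspaceT => t.
  by apply: differentiable_continuous; apply/derivable1_diffP; case: (dphi t).
have phi0 : phi 0 = g x by rewrite /phi scale0r addr0.
rewrite -/(phi s) -phi0.
have [s0|s0] := leP 0 s.
  have [t] := MVT_segment s0 (fun t _ => dphi t) (cphi 0 s).
  rewrite in_itv/= => /andP[t0 ts] ->; exists t; last by rewrite subr0 mulrC.
  by rewrite !ger0_norm.
have [t] := MVT_segment (ltW s0) (fun t _ => dphi t) (cphi s 0).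
rewrite in_itv/= => /andP[ts t0] E; exists t.
  by rewrite !ler0_norm ?lerN2// ltW.
by rewrite -opprB E sub0r mulrN opprK mulrC.
Qed.

(** Change one coordinate of the displacement h at a time: by the mean value
theorem each change costs at most |h_j| times a bound of the j-th partial
derivative near x, which exists since that derivative is continuous. *)
Lemma continuous_of_partials (p : nat) (g : 'rV[R]_p -> R) :
  (forall j x, derivable g x (e_ j)) -> (forall j, continuous (partial j g)) ->
  continuous g.
Proof.
move=> dg cg x.
have bound k : (k <= p)%N -> forall e, 0 < e -> exists2 d, 0 < d &
    forall h : 'rV[R]_p, `|h| < d -> (forall i : 'I_p, (k <= i)%N -> h 0 i = 0) ->
    `|g (x + h) - g x| < e.
  elim: k => [_ e e0|k IH kp e e0].
    exists 1 => // h _ h0; rewrite (_ : h = 0) ?addr0 ?subrr ?normr0//.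
    by apply/rowP => i; rewrite h0// mxE.
  (* h' is h with its last allowed coordinate j erased, so that x + h is reached
     from x + h' along e_j. *)
  pose j := Ordinal kp.
  have e20 : 0 < e / 2 by rewrite divr_gt0.
  have [d1 d10 H1] := IH (ltnW kp) _ e20.
  have /cvgrPdist_lt/(_ _ ltr01)/nbhs_ballP[d2 d20 H2] := cg j x.
  pose M := `|partial j g x| + 1.
  have M0 : 0 < M by rewrite ltr_wpDl.
  (* d1 makes the step from x to x + h' cost less than e / 2; d2 keeps the
     segment from x + h' to x + h where d_j g is below M, and |h| < e / (2 M)
     then bounds the cost of that segment. *)
  exists (Num.min d1 (Num.min d2 (e / 2 / M))).
    by rewrite !lt_min d10 d20 divr_gt0.
  move=> h; rewrite !lt_min => /and3P[hd1 hd2 hM] h0.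
  pose h' := h - h 0 j *: e_ j.
  have h'E i : h' 0 i = if i == j then 0 else h 0 i.
    rewrite !mxE eqxx/=; case: eqP => [->|_]; first by rewrite mulr1 subrr.
    by rewrite mulr0 subr0.
  have h'h : `|h'| <= `|h|.
    apply: rV_norm_le => // i; rewrite h'E; case: ifP => _; first by rewrite normr0.
    exact: coord_le_norm.
  have [t tE] := @mean_value_dir _ g (x + h') (e_ j) (h 0 j) (fun t => dg _ _).
  rewrite -addrA subrK => gE.
  have xt : `|partial j g (x + h' + t *: e_ j)| < M.
    have /H2 : ball x d2 (x + h' + t *: e_ j).
      rewrite -ball_normE /= -addrA opprD addNKr normrN.
      apply: le_lt_trans hd2; apply: rV_norm_le => // i.
      rewrite mxE h'E !mxE eqxx/=; have [_|_] := eqVneq i j.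
        by rewrite add0r mulr1 (le_trans tE)// coord_le_norm.
      by rewrite mulr0 addr0 coord_le_norm.
    rewrite distrC => H; rewrite /M -ltrBlDl; apply: le_lt_trans H.
    exact: lerB_dist.
  rewrite -(subrK (g (x + h')) (g (x + h))) -addrA (le_lt_trans (ler_normD _ _))//.
  rewrite (splitr e) ltrD//; last first.
    apply: H1; first exact: le_lt_trans h'h _.
    move=> i ki; rewrite h'E; case: eqP => // /eqP ij.
    by apply: h0; rewrite ltn_neqAle ki andbT eq_sym.
  rewrite gE normrM -(divfK (lt0r_neq0 M0) (e / 2)).
  apply: ltr_pM => //; first exact: le_lt_trans (coord_le_norm _ _) _.
apply/(@cvgrPdist_lt _ R _ (nbhs (x : 'rV[R]_p))) => e e0; have [d d0 H] := bound p (leqnn _) _ e0.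
apply/nbhs_ballP; exists d => // y; rewrite -ball_normE /= => xy.
rewrite distrC (_ : y = x + (y - x)); last by rewrite addrC subrK.
apply: H; first by rewrite distrC.
by move=> i; rewrite leqNgt ltn_ord.
Qed.

End calculus.

(** * Integrals depending on a parameter *)

Section parameter_integrals.
Context {R : realType} d {W : measurableType d} (mu : {measure set W -> \bar R}).
Context (Z : set W) (mZ : measurable Z) (Zfin : (mu Z < +oo)%E).

(** Over a set of finite measure uniform convergence is enough to pass to the
limit, and it is available for an arbitrary filter of parameters. *)
Lemma cvg_Rintegral_unif (Q : Type) (F : set_system Q) {FF : Filter F}
    (Phi : Q -> W -> R) (Phi0 : W -> R) :
  (\forall q \near F, mu.-integrable Z (EFin \o Phi q)) ->
  mu.-integrable Z (EFin \o Phi0) ->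
  (forall e, 0 < e -> \forall q \near F, forall y, Z y -> `|Phi q y - Phi0 y| <= e) ->
  \int[mu]_(y in Z) Phi q y @[q --> F] --> \int[mu]_(y in Z) Phi0 y.
Proof.
move=> iPhi iPhi0 unif; apply/cvgrPdist_le => e e0.
(* The + 1 keeps m positive when Z is null. *)
pose m := fine (mu Z) + 1.
have m0 : 0 < m by rewrite ltr_wpDl// fine_ge0.
have em : 0 < e / m by rewrite divr_gt0.
near=> q.
have iq : mu.-integrable Z (EFin \o Phi q) by near: q.
have uq : forall y, Z y -> `|Phi q y - Phi0 y| <= e / m by near: q; exact: unif.
rewrite distrC -RintegralB//.
have iB : mu.-integrable Z (EFin \o (Phi q \- Phi0)).
  rewrite (_ : _ \o _ = (fun y => (Phi q y)%:E - (Phi0 y)%:E)%E) //.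
  exact: integrableB.
apply: le_trans (le_normr_Rintegral mZ iB) _.
apply: (@le_trans _ _ (\int[mu]_(y in Z) (cst (e / m) y))).
  apply: le_Rintegral => //.
  - by have := integrable_norm iB.
  - by apply: measurable_bounded_integrable => //; exact: bounded_cst.
rewrite Rintegral_cst// -[leRHS](divfK (lt0r_neq0 m0)) ler_wpM2l//.
  exact: ltW.
by rewrite lerDl.
Unshelve. all: by end_near. Qed.

(** By the mean value theorem the difference quotient of Phi at x is the
derivative Psi at a point at distance at most |h| |v| from x, so the uniform
continuity of Psi at x makes the quotients converge uniformly on Z. *)
Lemma is_derive_Rintegral (V : normedModType R) (Phi Psi : V -> W -> R) (x v : V) :
  (forall z, mu.-integrable Z (EFin \o Phi z)) ->
  mu.-integrable Z (EFin \o Psi x) ->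
  (forall z y, Z y -> is_derive z v (Phi ^~ y) (Psi z y)) ->
  (forall e, 0 < e -> \forall z \near x, forall y, Z y -> `|Psi z y - Psi x y| <= e) ->
  is_derive x v (fun z => \int[mu]_(y in Z) Phi z y) (\int[mu]_(y in Z) Psi x y).
Proof.
move=> iPhi iPsi dPhi unif; pose H z := \int[mu]_(y in Z) Phi z y.
suff lim : h^-1 *: (H (h *: v + x) - H x) @[h --> 0^'] --> \int[mu]_(y in Z) Psi x y.
  by split; [apply/cvg_ex; eexists; exact: lim | exact: cvg_lim lim].
pose Q (h : R) y := h^-1 * (Phi (h *: v + x) y - Phi x y).
have iB h : mu.-integrable Z (EFin \o (fun y => Phi (h *: v + x) y - Phi x y)).
  rewrite (_ : _ \o _ = (fun y => (Phi (h *: v + x) y)%:E - (Phi x y)%:E)%E) //.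
  by apply: integrableB => //; exact: iPhi.
have HE h : h^-1 *: (H (h *: v + x) - H x) = \int[mu]_(y in Z) Q h y.
  by rewrite RintegralZl// RintegralB//; exact: iPhi.
rewrite (_ : (fun h => h^-1 *: _) = (fun h => \int[mu]_(y in Z) Q h y)); last exact/funext.
apply: cvg_Rintegral_unif => //.
  apply: nearW => h.
  rewrite (_ : _ \o _ = (fun y => (h^-1)%:E * (Phi (h *: v + x) y - Phi x y)%:E)%E) //.
  by apply: (integrableZl mZ); exact: iB.
move=> e e0; have /nbhs_ballP[r r0 Hr] := unif e e0.
have v0 : 0 < `|v| + 1 by rewrite ltr_wpDl.
have rv : 0 < r / (`|v| + 1) by rewrite divr_gt0.
near=> h => y Zy.
have h0 : h != 0 by near: h; exact: nbhs_dnbhs_neq.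
have hr : `|h| < r / (`|v| + 1) by near: h; exact: dnbhs0_lt.
have [t th E] := @mean_value_dir R V (Phi ^~ y) x v h
  (fun t => let: DeriveDef D _ := dPhi (x + t *: v) y Zy in D).
rewrite /Q [h *: v + x]addrC E mulKf//.
have [_ ->] := dPhi (x + t *: v) y Zy; apply: Hr => //.
rewrite -ball_normE /= opprD addNKr normrN normrZ.
apply: (@le_lt_trans _ _ (`|h| * (`|v| + 1))).
  by rewrite ler_pM// lerDl.
by rewrite -ltr_pdivlMr.
Unshelve. all: by end_near. Qed.

(** This is the tube lemma, in the form of the near-covering property of compact
sets: continuity at a parameter is uniform in the compact variable. *)
Lemma near_unif_compact (T U : topologicalType) (K : set U) (Phi : T -> U -> R) (q0 : T) :
  compact K -> (forall y, K y -> {for (q0, y), continuous (fun z => Phi z.1 z.2)}) ->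
  forall e, 0 < e -> \forall q \near q0, forall y, K y -> `|Phi q y - Phi q0 y| <= e.
Proof.
move=> cK cPhi e e0; have e20 : 0 < e / 2 by rewrite divr_gt0.
have /compact_near_coveringP nK := cK.
apply: (nK T (nbhs q0) (fun q y => `|Phi q y - Phi q0 y| <= e)) => y Ky.
have /cvgrPdist_lt/(_ _ e20) [[A B] /= [nA nB] AB] := cPhi y Ky.
exists (B, A) => //= -[y' q] /= [By' Aq].
have := AB (q, y') (conj Aq By').
have := AB (q0, y') (conj (nbhs_singleton nA) By').
rewrite /= => H0 H1.
rewrite -(subrK (Phi q0 y) (Phi q y')) -addrA.
rewrite (le_trans (ler_normD _ _))// (splitr e) lerD// ltW//.
by rewrite distrC.
Qed.

End parameter_integrals.

(** * Lebesgue measure under dilations and translations *)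

Section affine_change_of_variables.
Context {R : realType}.
Local Open Scope ereal_scope.

Lemma measurable_affine1 (a t : R) :
  measurable_fun setT (fun y : measurableTypeR R => (a + t * y)%R : measurableTypeR R).
Proof. by apply: measurable_funD => //; apply: measurable_funM. Qed.

(** Both sides are measures in A, so it is enough to compare them on intervals. *)
Lemma lebesgue_affine (a t : R) (A : set (measurableTypeR R)) : (0 < t)%R -> measurable A ->
  t%:E * lebesgue_measure
    ((fun y : measurableTypeR R => (a + t * y)%R : measurableTypeR R) @^-1` A) =
  lebesgue_measure A.
Proof.
move=> t0 mA.
pose phi := fun y : measurableTypeR R => (a + t * y)%R : measurableTypeR R.
pose push : {measure set (measurableTypeR R) -> \bar R} :=
  measure_function_pushforward__canonical__measure_function_Measure
    (@lebesgue_measure R) (measurable_affine1 a t).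
pose m' := mscale (NngNum (ltW t0)) push.
rewrite -[LHS]/(m' A); apply/esym/(@lebesgue_measure_unique R m') => // _ [[u v] _ <-].
rewrite -[RHS]/(t%:E * lebesgue_measure (phi @^-1` `]u, v]%classic)); apply/esym.
rewrite (_ : _ @^-1` _ = `](u - a) / t, (v - a) / t]%classic)%R; last first.
  by apply/seteqP; split => y; rewrite /= !in_itv/= ltr_pdivrMr// ler_pdivlMr//
    ltrBlDl lerBrDl (mulrC y).
rewrite !lebesgue_measure_itv/= !lte_fin ltr_pM2r ?invr_gt0// ltrD2r.
case: ifPn => uv; last by rewrite mule0.
by rewrite -!EFinB -EFinM -mulrBl mulrC divfK ?gt_eqF// opprB addrA subrK.
Qed.

(** The products of measurable sets form a pi-system that generates the
sigma-algebra of R^p, on which Lebesgue measure is the product of lengths. *)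
Definition boxes (p : nat) : set (set 'rV[R]_p) :=
  [set A | exists B : 'I_p -> set (measurableTypeR R),
    (forall i, measurable (B i)) /\ A = [set x : 'rV[R]_p | forall i, B i (x 0%R i)]].

Lemma measurable_boxes (p : nat) : @measurable _ 'rV[R]_p = <<s @boxes p >>.
Proof.
apply/seteqP; split.
  apply: smallest_sub; first exact: smallest_sigma_algebra.
  rewrite -bigcup_seq => A /= [i _ [B mB <-]]; apply: sub_sigma_algebra.
  exists (fun j => if j == i then B else setT); split.
    by move=> j; case: ifP.
  rewrite setTI; apply/seteqP; split => x /=.
    by move=> Bx j; case: eqP => [->|].
  by move=> /(_ i); rewrite eqxx.
apply: smallest_sub; first exact: sigma_algebra_measurable.
move=> _ [B [mB ->]].
rewrite (_ : [set _ | _] = \big[setI/setT]_(i < p) (rV_coord i @^-1` B i)).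
  apply: bigsetI_measurable => i _.
  by rewrite -[X in measurable X]setTI; apply: measurable_rV_coord => //; exact: mB.
rewrite -bigcap_seq; apply/seteqP; split => [x Ax i _|x Ax]; first exact: Ax.
by move=> i; apply: (Ax i); rewrite /= mem_index_enum.
Qed.

Lemma measurable_affine (p : nat) (x : 'rV[R]_p) (t : R) :
  measurable_fun setT (fun y : 'rV[R]_p => (x + t *: y)%R).
Proof.
apply: measurable_fun_rVP => i.
rewrite (_ : _ \o _ = (fun y => x 0%R i + t * rV_coord i y)%R); last first.
  by apply/funext => y; rewrite /rV_coord /= !mxE.
by apply: measurable_funD => //; apply: measurable_funM => //; exact: measurable_rV_coord.
Qed.

Lemma lebesgue_rV_cube (p : nat) (u v : R) : (u <= v)%R ->
  lebesgue_rV p [set x : 'rV[R]_p | forall i, `[u, v]%classic (x 0%R i)] = ((v - u) ^+ p)%:E.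
Proof.
move=> uv; rewrite (lebesgue_rV_box (A := fun=> `[u, v]%classic))//.
rewrite (eq_bigr (fun=> (v - u)%:E)).
  by rewrite prodEFin prodr_const card_ord.
move=> i _; rewrite lebesgue_measure_itv/= lte_fin EFinB.
by case: ltgtP uv => // ->; rewrite -EFinB subrr.
Qed.

(** On boxes the identity is a product of p one-dimensional instances; boxes
determine a measure which is finite on cubes. *)
Lemma lebesgue_rV_affine (p : nat) (x : 'rV[R]_p) (t : R) (A : set 'rV[R]_p) :
  (0 < t)%R -> measurable A ->
  (t ^+ p)%:E * lebesgue_rV p ((fun y => (x + t *: y)%R) @^-1` A) = lebesgue_rV p A.
Proof.
move=> t0 mA.
pose push : {measure set 'rV[R]_p -> \bar R} :=
  measure_function_pushforward__canonical__measure_function_Measure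
    (lebesgue_rV p) (measurable_affine x t).
pose m' := mscale (NngNum (exprn_ge0 p (ltW t0))) push.
pose g k : set 'rV[R]_p := [set x : 'rV[R]_p | forall i, `[(- k%:R)%R, k%:R]%classic (x 0%R i)].
rewrite -[LHS]/(m' A).
apply/esym; apply: (@measure_unique _ _ _ (@boxes p) g _ _ _ _ (lebesgue_rV p) m') => //.
- exact: measurable_boxes.
- move=> _ _ [B [mB ->]] [C [mC ->]]; exists (fun i => B i `&` C i).
  split; first by move=> i; exact: measurableI.
  apply/seteqP; split => [y [yB yC] i|y yBC]; first by split.
  by split => i; case: (yBC i).
- by move=> k; exists (fun=> `[(- k%:R)%R, k%:R]%classic).
- apply/seteqP; split => // y _; exists (Num.truncn `|y|).+1 => // i /=.
  rewrite in_itv/= -ler_norml (le_trans (coord_le_norm _ _))//.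
  by rewrite ltW// truncnS_gt.
- move=> _ [B [mB ->]].
  rewrite -[RHS]/((t ^+ p)%:E * lebesgue_rV p
    ((fun y => (x + t *: y)%R) @^-1` [set y : 'rV[R]_p | forall i, B i (y 0%R i)])).
  pose C i := (fun s : measurableTypeR R => (x 0 i + t * s)%R : measurableTypeR R) @^-1` B i.
  have mC i : measurable (C i).
    by rewrite -[X in measurable X]setTI; apply: measurable_affine1 => //; exact: mB.
  rewrite (_ : _ @^-1` _ = [set y : 'rV[R]_p | forall i, C i (y 0%R i)]); last first.
    by apply/seteqP; split => y /= yB i; have := yB i; rewrite !mxE.
  transitivity (\prod_(i < p) lebesgue_measure (B i)); first exact: (lebesgue_rV_box mB).
  transitivity ((t ^+ p)%:E * \prod_(i < p) lebesgue_measure (C i)); last first.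
    by congr (_ * _); apply/esym; exact: (lebesgue_rV_box mC).
  rewrite -[p in (t ^+ p)%R]card_ord -prodr_const -prodEFin -big_split/=.
  by apply: eq_bigr => i _; rewrite lebesgue_affine.
- move=> k; have kk : (- k%:R <= k%:R :> R)%R by rewrite -subr_ge0 opprK addr_ge0.
  have : lebesgue_rV p (g k) < +oo by rewrite (lebesgue_rV_cube p kk) ltry.
  exact.
Qed.

End affine_change_of_variables.

(** * Integration against a density *)

Section densities.
Context {R : realType}.
Local Open Scope ereal_scope.

(** The density coincides almost everywhere with the Radon-Nikodym derivative,
for which the change of variables is known. *)
Lemma ge0_integral_density d (T : measurableType d) (P : probability T R)
    (mu : {sigma_finite_measure set T -> \bar R}) (f : T -> R) (u : T -> \bar R) :
  P `<< mu -> measurable_fun setT f -> (forall x, (0 <= f x)%R) ->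
  (forall A, measurable A -> P A = \int[mu]_(x in A) (f x)%:E) ->
  measurable_fun setT u -> (forall x, 0 <= u x) ->
  \int[P]_x u x = \int[mu]_x (u x * (f x)%:E).
Proof.
move=> Pmu mf f0 Pf mu_ u0.
rewrite -(Radon_Nikodym_SigmaFinite.change_of_variables Pmu)//.
set rn := Radon_Nikodym_SigmaFinite.f _ _.
have irn : mu.-integrable setT rn by exact: Radon_Nikodym_SigmaFinite.f_integrable.
have mef : measurable_fun setT (EFin \o f) by exact/measurable_EFinP.
apply: ae_eq_integral => //.
- by apply: emeasurable_funM => //; exact: measurable_int irn.
- exact: emeasurable_funM.
- apply: ae_eqe_mul2l; apply: integral_ae_eq => // A _ mA.
  exact: etrans (esym (Radon_Nikodym_SigmaFinite.f_integral Pmu mA)) (Pf A mA).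
Qed.

Lemma ge0_integral_affine (p : nat) (x : 'rV[R]_p) (t : R) (u : 'rV[R]_p -> \bar R) :
  (0 < t)%R -> measurable_fun setT u -> (forall y, 0 <= u y) ->
  \int[lebesgue_rV p]_y u y = (t ^+ p)%:E * \int[lebesgue_rV p]_y u (x + t *: y)%R.
Proof.
move=> t0 mu u0.
pose push : {measure set 'rV[R]_p -> \bar R} :=
  measure_function_pushforward__canonical__measure_function_Measure
    (lebesgue_rV p) (measurable_affine x t).
pose m' := mscale (NngNum (exprn_ge0 p (ltW t0))) push.
rewrite (@eq_measure_integral _ _ _ setT m' (lebesgue_rV p)).
  rewrite ge0_integral_mscale//=; congr (_ * _).
  rewrite (@ge0_integral_pushforward _ _ _ _ _ _ (measurable_affine x t))//.
by move=> A mA _; exact: (esym (lebesgue_rV_affine x t0 mA)).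
Qed.

Context {p : nat}.
Notation leb := (@lebesgue_rV R p).
Notation leb2 := (leb \x leb).

(** Tonelli reduces the dilation of R^p x R^p to two successive dilations of R^p. *)
Lemma ge0_integral_affine2 (x : 'rV[R]_p) (t : R) (u : 'rV[R]_p * 'rV[R]_p -> \bar R) :
  (0 < t)%R -> measurable_fun setT u -> (forall y, 0 <= u y) ->
  \int[leb2]_z u z = (t ^+ p)%:E * (t ^+ p)%:E *
    \int[leb2]_z u ((x + t *: z.1)%R, (x + t *: z.2)%R).
Proof.
move=> t0 mu u0; have tp0 : (0 <= t ^+ p)%R by rewrite exprn_ge0// ltW.
pose T z : 'rV[R]_p * 'rV[R]_p := ((x + t *: z.1)%R, (x + t *: z.2)%R).
have mT : measurable_fun setT T.
  by apply: measurable_fun_pair; apply: (measurableT_comp (measurable_affine x t)).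
have muT : measurable_fun setT (u \o T) by exact: measurableT_comp.
rewrite fubini_tonelli1// (@fubini_tonelli1 _ _ _ _ _ leb leb (u \o T))//; last first.
  by move=> z; exact: u0.
have mF (v : 'rV[R]_p * 'rV[R]_p -> \bar R) : measurable_fun setT v ->
    (forall z, 0 <= v z) -> measurable_fun setT (fubini_F leb v).
  by move=> mv v0; apply: measurable_fun_fubini_tonelli_F.
rewrite (ge0_integral_affine x t0)/=; last 2 first.
- exact: mF.
- by move=> y; exact: integral_ge0.
rewrite -muleA; congr (_ * _); rewrite -ge0_integralZl//; last 2 first.
- by apply: mF => // z; exact: u0.
- by move=> y _; apply: integral_ge0 => z _; exact: u0.
apply: eq_integral => a _; rewrite /fubini_F (ge0_integral_affine x t0)//.
exact: measurableT_comp.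
Qed.

(** The measure P x P has density f(x1) f(x2): integrate first the x1-section of A
against f, then the resulting function of x1. *)
Lemma product_density (P : probability 'rV[R]_p R) (f : 'rV[R]_p -> R)
    (A : set ('rV[R]_p * 'rV[R]_p)) :
  P `<< leb -> is_density P f -> measurable A ->
  (P \x P) A = \int[leb2]_(z in A) (f z.1 * f z.2)%:E.
Proof.
move=> Pac [mf f0 Pf] mA.
pose F z : \bar R := (f z.1 * f z.2)%:E * (\1_A z)%:E.
have F0 z : 0 <= F z by rewrite mule_ge0// lee_fin mulr_ge0.
have mF : measurable_fun setT F.
  apply: emeasurable_funM; apply/measurable_EFinP => //.
  by apply: measurable_funM; apply: measurableT_comp.
rewrite integral_mkcond epatch_indic.
rewrite (@fubini_tonelli1 _ _ _ _ _ leb leb F)//.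
rewrite [LHS]/product_measure1 (ge0_integral_density Pac mf f0 Pf)//; last first.
  exact: measurable_fun_xsection.
apply: eq_integral => a _; rewrite /fubini_F /=.
rewrite Pf; last exact: measurable_xsection.
rewrite integral_mkcond epatch_indic muleC -ge0_integralZl//; last 3 first.
- apply: emeasurable_funM; apply/measurable_EFinP => //.
  by apply: measurable_indic; exact: measurable_xsection.
- by move=> b _; rewrite mule_ge0// lee_fin.
- by rewrite lee_fin.
apply: eq_integral => b _; rewrite /F /= EFinM muleA; congr (_ * _%:E).
by rewrite !indicE mem_xsection.
Qed.

End densities.

(** * The lens and the rescaled local lens depth *)

Section lens_geometry.
Context {R : realType} {p : nat}.
Implicit Types (x v w : 'rV[R]_p) (z : 'rV[R]_p * 'rV[R]_p).
Notation leb := (@lebesgue_rV R p).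
Notation leb2 := (leb \x leb)%E.

Lemma measurable_enorm : measurable_fun setT (@enorm R p).
Proof.
apply: (@measurableT_comp _ _ _ _ _ _ (@Num.sqrt R)).
  exact: continuous_measurable_fun (@sqrt_continuous R).
apply: measurable_sum => i; apply: measurable_funX; exact: measurable_rV_coord.
Qed.

Lemma enormZ (t : R) v : 0 <= t -> enorm (t *: v) = t * enorm v.
Proof.
move=> t0; rewrite /enorm -{2}(ger0_norm t0) -sqrtr_sqr -sqrtrM ?sqr_ge0//.
by rewrite mulr_sumr; congr Num.sqrt; apply: eq_bigr => i _; rewrite mxE exprMn.
Qed.

Lemma coord_le_enorm v (i : 'I_p) : `|v 0 i| <= enorm v.
Proof.
rewrite -sqrtr_sqr ler_wsqrtr// (bigD1 i)//= lerDl sumr_ge0// => j _.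
exact: sqr_ge0.
Qed.

Lemma norm_le_enorm v : `|v| <= enorm v.
Proof. by apply: rV_norm_le => [|i]; [exact: sqrtr_ge0|exact: coord_le_enorm]. Qed.

Lemma ler_enorm v w : (forall i, `|v 0 i| <= `|w 0 i|) -> enorm v <= enorm w.
Proof.
move=> vw; rewrite ler_wsqrtr// ler_sum// => i _.
by rewrite -[leLHS]real_normK ?num_real// -[leRHS]real_normK ?num_real// lerXn2r ?nnegrE.
Qed.

Lemma measurable_lens (tau : R) x : measurable (lens tau%:E x).
Proof.
have menorm (g : 'rV[R]_p * 'rV[R]_p -> 'rV[R]_p) :
    measurable_fun setT g -> measurable_fun setT (fun z => enorm (g z)).
  by move=> mg; apply: measurableT_comp => //; exact: measurable_enorm.
have mB (g h : 'rV[R]_p * 'rV[R]_p -> 'rV[R]_p) : measurable_fun setT g ->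
    measurable_fun setT h -> measurable_fun setT (fun z => g z - h z).
  move=> mg mh; apply: measurable_fun_rVP => i.
  rewrite (_ : _ \o _ = (rV_coord i \o g) \- (rV_coord i \o h)); last first.
    by apply/funext => z; rewrite /rV_coord /= !mxE.
  by apply: measurable_funB; apply: measurableT_comp => //; exact: measurable_rV_coord.
have m3 : measurable_fun setT (fun z => enorm (z.1 - z.2)) by apply: menorm; exact: mB.
have := @measurable_fun_ler _ _ R setT (fun z => Num.max (enorm (x - z.1)) (enorm (x - z.2)))
  (fun z => enorm (z.1 - z.2)).
move=> /(_ _ m3 measurableT [set true] I) H1.
have := @measurable_fun_ler _ _ R setT (fun z => enorm (z.1 - z.2)) (cst tau).
move=> /(_ m3 (measurable_cst _) measurableT [set true] I) H2.
rewrite (_ : lens _ _ =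
  (setT `&` (fun z => Num.max (enorm (x - z.1)) (enorm (x - z.2)) <= enorm (z.1 - z.2))
    @^-1` [set true]) `&`
  (setT `&` (fun z => enorm (z.1 - z.2) <= tau) @^-1` [set true])).
  apply: measurableI => //; apply: H1; apply: measurable_maxr; apply: menorm; exact: mB.
by rewrite !setTI; apply/seteqP; split => z; rewrite /lens /= lee_fin.
Qed.

(** Distances are multiplied by t under y |-> x + t y, so the inequalities which
define the lens are homogeneous. *)
Lemma lens_affine x (t : R) z : 0 < t ->
  lens t%:E x (x + t *: z.1, x + t *: z.2) <-> lens 1%:E 0 z.
Proof.
move=> t0; have t0' := ltW t0; rewrite /lens /= !lee_fin.
rewrite (_ : x + t *: z.1 - (x + t *: z.2) = t *: (z.1 - z.2)); last first.
  by rewrite opprD addrACA subrr add0r scalerBr.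
rewrite !opprD !addNKr -!scalerN !sub0r !enormZ//.
by rewrite -maxr_pMr// ler_pM2l// ger_pMr.
Qed.

Lemma lens_bounded z : lens 1%:E 0 z -> `|z.1| <= 1 /\ `|z.2| <= 1.
Proof.
rewrite /lens /= lee_fin ge_max !sub0r => -[/andP[z1 z2] z12].
by split; rewrite -normrN (le_trans (norm_le_enorm _))// (le_trans _ z12).
Qed.

Lemma lens_fin : (leb2 (lens 1%:E 0%R) < +oo)%E.
Proof.
pose C : set 'rV[R]_p := [set x : 'rV[R]_p | forall i, `[- 1, 1]%classic (x 0 i)].
have mC : measurable C.
  rewrite measurable_boxes; apply: sub_sigma_algebra.
  by exists (fun=> `[- 1, 1]%classic).
apply: (@le_lt_trans _ _ (leb2 (C `*` C))).
  apply: le_measure; rewrite ?inE//; [exact: measurable_lens|exact: measurableX|].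
  move=> z /lens_bounded[z1 z2]; split => i /=; rewrite in_itv/= -ler_norml;
    exact: le_trans (coord_le_norm _ _) _.
rewrite [ltLHS](product_measure1E _ _ mC mC).
have N11 : - 1 <= 1 :> R by lra.
have lC : leb C = ((1 - - 1) ^+ p)%:E by exact: lebesgue_rV_cube.
have : (leb C * leb C < +oo)%E by rewrite lC -EFinM ltry.
exact.
Qed.

(** The lens contains a product of two cubes of positive measure.  If all
coordinates of y1 lie in [a, 2a] and those of y2 in [-2a, -a], then
coordinatewise |y_i| <= 2a <= y1 - y2 <= 4a. *)
Lemma Lambda1_gt0 : (0 < p)%N -> 0 < @Lambda1 R p.
Proof.
move=> p0; apply: fine_gt0; rewrite lens_fin andbT.
have pR : 0 < p%:R :> R by rewrite ltr0n.
(* This value gives |y1 - y2|^2 <= p (4a)^2 = 1/p <= 1. *)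
pose a : R := (4 * p%:R)^-1; have a0 : 0 < a by rewrite invr_gt0 mulr_gt0.
pose C (u v : R) : set 'rV[R]_p := [set x : 'rV[R]_p | forall i, `[u, v]%classic (x 0 i)].
have mC (u v : R) : measurable (C u v).
  rewrite measurable_boxes; apply: sub_sigma_algebra.
  by exists (fun=> `[u, v]%classic).
apply: (@lt_le_trans _ _ (leb2 (C a (2 * a) `*` C (- (2 * a)) (- a)))).
  rewrite [ltRHS](product_measure1E _ _ (mC _ _) (mC _ _)).
  have a1 : a <= 2 * a by lra.
  have a2 : - (2 * a) <= - a by lra.
  have l1 : leb (C a (2 * a)) = ((2 * a - a) ^+ p)%:E by exact: lebesgue_rV_cube.
  have l2 : leb (C (- (2 * a)) (- a)) = ((- a - - (2 * a)) ^+ p)%:E by exact: lebesgue_rV_cube.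
  have : (0 < leb (C a (2 * a)%R) * leb (C (- (2 * a))%R (- a)%R))%E.
    by rewrite l1 l2 -EFinM lte_fin mulr_gt0// exprn_gt0//; lra.
  exact.
apply: le_measure; rewrite ?inE//; [exact: measurableX|exact: measurable_lens|].
move=> z [/= C1 C2]; rewrite /lens /= lee_fin !sub0r.
have {}C1 i : a <= z.1 0 i <= 2 * a by have := C1 i; rewrite /= in_itv.
have {}C2 i : - (2 * a) <= z.2 0 i <= - a by have := C2 i; rewrite /= in_itv.
split.
  rewrite ge_max; apply/andP; split; apply: ler_enorm => i; rewrite !mxE normrN.
    have := C1 i; have := C2 i => /andP[? ?] /andP[? ?].
    by rewrite !ger0_norm; lra.
  have := C1 i; have := C2 i => /andP[? ?] /andP[? ?].
  rewrite ler0_norm ?ger0_norm; lra.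
rewrite -[leRHS]sqrtr1 ler_wsqrtr//.
apply: (@le_trans _ _ (\sum_(i < p) (4 * a) ^+ 2)).
  apply: ler_sum => i _; have := C1 i; have := C2 i => /andP[? ?] /andP[? ?].
  by rewrite !mxE lerXn2r ?nnegrE; lra.
rewrite sumr_const card_ord /a invfM mulrA mulfV// mul1r -[leLHS]mulr_natr.
rewrite expr2 -mulrA mulVf ?gt_eqF// mulr1 invf_le1// ler1n//.
Qed.

(** Change of variables x_i = x + t y_i in the depth, written with the density of
P x P.  The resulting integral is finite because P x P is a finite measure. *)
Lemma LLD_rescaled (P : probability 'rV[R]_p R) (f : 'rV[R]_p -> R) x (t : R) :
  P `<< leb -> is_density P f -> 0 < t ->
  LLD P x t%:E = t ^+ p * t ^+ p *
    \int[leb2]_(z in lens 1%:E 0) (f (x + t *: z.1) * f (x + t *: z.2)).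
Proof.
move=> Pac Pf t0; have [mf f0 _] := Pf.
have mL := measurable_lens t x.
have mF : measurable_fun setT (fun z : 'rV[R]_p * 'rV[R]_p => (f z.1 * f z.2)%:E).
  by apply/measurable_EFinP; apply: measurable_funM; apply: measurableT_comp.
have E : ((P \x P) (lens t%:E x) = (t ^+ p * t ^+ p)%:E *
   \int[leb2]_(z in lens 1%:E 0%R) (f (x + t *: z.1) * f (x + t *: z.2))%:E)%E.
  rewrite (product_density Pac Pf mL) integral_mkcond (ge0_integral_affine2 x t0).
  - rewrite EFinM; congr (_ * _)%E; rewrite [RHS]integral_mkcond.
    apply: eq_integral => z _; rewrite !patchE.
    by congr (if _ then _ else _); apply/idP/idP; rewrite !inE => /(lens_affine x z t0).
  - apply/(measurable_restrictT _ _).1 => //; exact: measurable_funTS.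
  - by move=> z; apply: erestrict_ge0 => y _; rewrite lee_fin mulr_ge0.
have tt : t ^+ p * t ^+ p > 0 by rewrite mulr_gt0// exprn_gt0.
have -> : LLD P x t%:E = fine ((P \x P)%E (lens t%:E x)).
  by rewrite /LLD /Rintegral integral_indic// setIT.
rewrite E fineM//.
rewrite ge0_fin_numE; last by apply: integral_ge0 => z _; rewrite lee_fin mulr_ge0.
have : ((P \x P) (lens t%:E x) < +oo)%E.
  apply: (@le_lt_trans _ _ ((P \x P) setT)%E); first by apply: le_measure; rewrite ?inE.
  rewrite -setXTT [ltLHS](product_measure1E P P measurableT measurableT).
  have : (P setT * P setT < +oo)%E by rewrite probability_setT mule1 ltry.
  exact.
(* If the integral were infinite, so would be the probability of the lens. *)
rewrite E; apply: contraTT; rewrite -!leNgt leye_eq => /eqP ->.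
by rewrite gt0_muley// lte_fin.
Qed.

End lens_geometry.

(** * Chain rule and measurability of partial derivatives *)

Section chain_rule.
Context {R : realType}.

(** A directional derivative is an ordinary derivative along a line, which
makes the rules of one-variable calculus available. *)
Lemma is_derive_lineP (V : normedModType R) (g : V -> R) (x v : V) (d : R) :
  is_derive x v g d <-> is_derive (0 : R) (1 : R) (fun h : R => g (h *: v + x)) d.
Proof.
have E : (fun h : R => h^-1 *: (g ((h *: (1 : R) + 0) *: v + x) - g (0 *: v + x)))
    = (fun h : R => h^-1 *: (g (h *: v + x) - g x)).
  by apply/funext => h; rewrite addr0 [h *: 1]mulr1 scale0r add0r.
by split => -[D1 D2]; split; move: D1 D2; rewrite /derivable /derive /= E.
Qed.

Lemma is_derive_chain (V : normedModType R) (F : R -> R) (g : V -> R) (x v : V) (a b : R) :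
  is_derive (g x) 1 F a -> is_derive x v g b -> is_derive x v (F \o g) (a * b).
Proof.
move=> dF /is_derive_lineP dg; apply/is_derive_lineP.
apply: (@is_derive1_comp R F (fun h => g (h *: v + x)) 0 a b) => //.
by rewrite scale0r add0r.
Qed.

Lemma is_derive_translate (V : normedModType R) (g : V -> R) (x v c : V) (d : R) :
  is_derive (x + c) v g d -> is_derive x v (fun y => g (y + c)) d.
Proof.
move=> /is_derive_lineP dg; apply/is_derive_lineP.
by under eq_fun do rewrite -addrA.
Qed.

Lemma is_derive_half_rsqrt (u : R) : 0 < u ->
  is_derive u 1 (fun w => (2 * Num.sqrt w)^-1) (- (4 * u * Num.sqrt u)^-1).
Proof.
move=> u0; have s0 : 0 < Num.sqrt u by rewrite sqrtr_gt0.
have ds : is_derive u 1 (fun w => 2 * Num.sqrt w) (2 *: (2 * Num.sqrt u)^-1).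
  apply: (is_deriveZ 2); exact: is_derive1_sqrt.
have -> : - (4 * u * Num.sqrt u)^-1 = - (2 * Num.sqrt u) ^- 2 *: (2 *: (2 * Num.sqrt u)^-1).
  rewrite -{1}(sqr_sqrtr (ltW u0)) /GRing.scale /=.
  by field; rewrite gt_eqF.
by apply: is_deriveV => //; rewrite gt_eqF// mulr_gt0.
Qed.

Lemma continuous_half_rsqrt (u : R) : 0 < u ->
  {for u, continuous (fun w : R => (2 * Num.sqrt w)^-1)}.
Proof.
move=> u0; apply: cvgV; first by rewrite gt_eqF// mulr_gt0// sqrtr_gt0.
by apply: cvgM; [exact: cvg_cst|exact: sqrt_continuous].
Qed.

Lemma continuous_derive_half_rsqrt (u : R) : 0 < u ->
  {for u, continuous (fun w : R => - (4 * w * Num.sqrt w)^-1)}.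
Proof.
move=> u0; apply: cvgN; apply: cvgV.
  by rewrite gt_eqF// mulr_gt0// ?sqrtr_gt0// mulr_gt0.
apply: cvgM; last exact: sqrt_continuous.
by apply: cvgM; [exact: cvg_cst|exact: cvg_id].
Qed.

(** A partial derivative is the pointwise limit of a sequence of difference
quotients, so the measurability of g is inherited. *)
Lemma measurable_partial (p : nat) (g : 'rV[R]_p -> R) (j : 'I_p) :
  measurable_fun setT g -> (forall x, derivable g x (e_ j)) ->
  measurable_fun setT (partial j g).
Proof.
move=> mg dg.
pose s (n : nat) : R := n.+1%:R^-1.
apply: (@measurable_fun_cvg _ _ _ _
  (fun n x => (s n)^-1 *: (g (s n *: e_ j + x) - g x))) => [n|x _].
  apply: measurable_funM => //; apply: measurable_funB => //.
  rewrite (_ : (fun x => _) = g \o (fun x => s n *: e_ j + 1 *: x)); last first.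
    by apply/funext => x; rewrite /= scale1r.
  by apply: measurableT_comp => //; exact: measurable_affine.
have H : h^-1 *: (g (h *: e_ j + x) - g x) @[h --> 0^'] --> partial j g x by exact: dg.
apply: ((cvgr_dnbhsP _ _ _).1 H s); split; last exact: cvg_harmonic.
by move=> n; rewrite gt_eqF// harmonic_gt0.
Qed.

End chain_rule.

(** * Averages over the unit lens *)

Section lens_mean.
Context {R : realType} {p : nat}.
Notation leb := (@lebesgue_rV R p).
Notation leb2 := (leb \x leb)%E.
Notation Z := (lens 1%:E (0 : 'rV[R]_p)).
Implicit Types (g h : 'rV[R]_p -> R) (x : 'rV[R]_p) (t : R).

(** The sigma-algebra of R^p is generated by the coordinates rather than by the
open sets, so measurability is recorded next to continuity. *)
Definition regular g := measurable_fun setT g /\ continuous g.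

Definition pair_prod g h t x (z : 'rV[R]_p * 'rV[R]_p) : R :=
  g (x + t *: z.1) * h (x + t *: z.2).

Definition lens_mean g h t x : R := (@Lambda1 R p)^-1 * \int[leb2]_(z in Z) pair_prod g h t x z.

(* The lens lies in the compact set C x C, over which continuity in the
parameters is uniform. *)
Let C : set 'rV[R]_p := [set x : 'rV[R]_p | forall i, `[(- 1 : R), 1]%classic (x 0 i)].

Let cC : compact (C `*` C).
Proof.
by apply: compact_setX; apply: (@rV_compact _ _ (fun=> `[(- 1 : R), 1]%classic)) => i;
  exact: segment_compact.
Qed.

Let ZC : Z `<=` C `*` C.
Proof.
move=> z /lens_bounded[z1 z2]; split => i /=; rewrite in_itv/= -ler_norml;
  exact: le_trans (coord_le_norm _ _) _.
Qed.

Lemma continuous_pair_prod g h : continuous g -> continuous h ->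
  continuous (fun w : (R * 'rV[R]_p) * ('rV[R]_p * 'rV[R]_p) =>
    pair_prod g h w.1.1 w.1.2 w.2).
Proof.
move=> cg ch [[t x] [y1 y2]].
have c1 : w.1.1 @[w --> ((t, x), (y1, y2))] --> t.
  by apply: (@cvg_comp _ _ _ fst fst); [exact: cvg_fst|exact: cvg_fst].
have c2 : w.1.2 @[w --> ((t, x), (y1, y2))] --> x.
  by apply: (@cvg_comp _ _ _ fst snd); [exact: cvg_fst|exact: cvg_snd].
have c3 : w.2.1 @[w --> ((t, x), (y1, y2))] --> y1.
  by apply: (@cvg_comp _ _ _ snd fst); [exact: cvg_snd|exact: cvg_fst].
have c4 : w.2.2 @[w --> ((t, x), (y1, y2))] --> y2.
  by apply: (@cvg_comp _ _ _ snd snd); [exact: cvg_snd|exact: cvg_snd].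
apply: cvgM.
- by apply: continuous_cvg; [exact: cg|apply: cvgD => //; exact: cvgZ].
- by apply: continuous_cvg; [exact: ch|apply: cvgD => //; exact: cvgZ].
Qed.

Lemma integrable_pair_prod g h t x : regular g -> regular h ->
  leb2.-integrable Z (EFin \o pair_prod g h t x).
Proof.
move=> [mg cg] [mh ch].
have mZ : measurable Z by exact: measurable_lens.
apply: measurable_bounded_integrable => //; first exact: lens_fin.
  apply: measurable_funTS; apply: measurable_funM.
  - apply: measurableT_comp => //; apply: (measurableT_comp (measurable_affine x t)) => //.
  - apply: measurableT_comp => //; apply: (measurableT_comp (measurable_affine x t)) => //.
have cP : continuous (pair_prod g h t x).
  move=> z; apply: (@continuous_comp _ _ _ (fun z => ((t, x), z))
    (fun w => pair_prod g h w.1.1 w.1.2 w.2)); last exact: continuous_pair_prod.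
  by rewrite /continuous_at /=; apply: (@cvg_pair _ _ _ _ (nbhs (t, x)) (nbhs z));
    [exact: cvg_cst|exact: cvg_id].
have /compact_bounded[M [_ mrt]] := continuous_compact (continuous_subspaceT cP) cC.
by exists M; split; rewrite ?num_real // => e Me z Zz; apply: mrt => //; exists z => //; exact: ZC.
Qed.

(** Joint continuity up to and including t = 0 is what turns the limit of small
scales into an evaluation. *)
Lemma continuous_lens_mean g h : regular g -> regular h ->
  continuous (fun q : R * 'rV[R]_p => lens_mean g h q.1 q.2).
Proof.
move=> rg rh q; apply: cvgM; first exact: cvg_cst.
apply: cvg_Rintegral_unif.
- exact: measurable_lens.
- exact: lens_fin.
- by apply: nearW => q'; exact: integrable_pair_prod.
- exact: integrable_pair_prod.
- move=> e e0.
  have := @near_unif_compact _ _ _ (C `*` C) (fun q z => pair_prod g h q.1 q.2 z) q cC.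
  move=> /(_ _ _ e0) H; apply: filterS (H _).
    by move=> q' H' z /ZC; exact: H'.
  by move=> z _; apply: (continuous_pair_prod rg.2 rh.2).
Qed.

(** At scale zero the integrand is constant, and Lambda1 is the measure of Z. *)
Lemma lens_mean0 g h x : (0 < p)%N -> lens_mean g h 0 x = g x * h x.
Proof.
move=> p0; rewrite /lens_mean.
rewrite (@eq_Rintegral _ _ _ leb2 _ (cst (g x * h x))); last first.
  by move=> z _; rewrite /pair_prod !scale0r addr0.
rewrite Rintegral_cst; last exact: measurable_lens.
by rewrite mulrC mulfK// gt_eqF// Lambda1_gt0.
Qed.

(** For fixed t the integrand depends on x through translations only, so its
derivative is given by the product rule, and it is of the same form. *)
Lemma is_derive_lens_mean g h t x (j : 'I_p) :
  regular g -> regular h -> regular (partial j g) -> regular (partial j h) ->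
  (forall y, derivable g y (e_ j)) -> (forall y, derivable h y (e_ j)) ->
  is_derive x (e_ j) (lens_mean g h t)
    (lens_mean (partial j g) h t x + lens_mean g (partial j h) t x).
Proof.
move=> rg rh rdg rdh dg dh.
pose Psi y z := pair_prod (partial j g) h t y z + pair_prod g (partial j h) t y z.
have mZ : measurable Z by exact: measurable_lens.
have -> : lens_mean (partial j g) h t x + lens_mean g (partial j h) t x =
    (@Lambda1 R p)^-1 *: \int[leb2]_(z in Z) Psi x z.
  rewrite -mulrDr -RintegralD//; exact: integrable_pair_prod.
apply: (is_deriveZ (@Lambda1 R p)^-1); apply: is_derive_Rintegral => //.
- exact: lens_fin.
- by move=> y; exact: integrable_pair_prod.
- rewrite (_ : _ \o _ = (fun z => (pair_prod (partial j g) h t x z)%:E +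
    (pair_prod g (partial j h) t x z)%:E)%E) //.
  by apply: integrableD => //; exact: integrable_pair_prod.
- move=> y z _; rewrite /Psi /pair_prod.
  rewrite addrC [X in _ + X]mulrC.
  apply: is_deriveM; apply: is_derive_translate; exact: derivableP.
- move=> e e0.
  have := @near_unif_compact _ _ _ (C `*` C) Psi x cC.
  move=> /(_ _ _ e0) H; apply: filterS (H _).
    by move=> q' H' z /ZC; exact: H'.
  move=> z _.
  have c0 : ((t, w.1), w.2) @[w --> (x, z)] --> ((t, x), z).
    apply: (@cvg_pair _ _ _ _ (nbhs (t, x)) (nbhs z)); last exact: cvg_snd.
    by apply: (@cvg_pair _ _ _ _ (nbhs t) (nbhs x)); [exact: cvg_cst|exact: cvg_fst].
  have c (g' h' : 'rV[R]_p -> R) : continuous g' -> continuous h' ->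
      pair_prod g' h' t w.1 w.2 @[w --> (x, z)] --> pair_prod g' h' t x z.
    move=> cg' ch'.
    by apply: (@cvg_comp _ _ _ _ (fun w : (R * 'rV[R]_p) * ('rV[R]_p * 'rV[R]_p) =>
      pair_prod g' h' w.1.1 w.1.2 w.2) _ _ _ c0); exact: continuous_pair_prod.
  by apply: cvgD; apply: c; [exact: rdg.2|exact: rh.2|exact: rg.2|exact: rdh.2].
Qed.

(** The factor t^p of f_t cancels the square root of the Jacobian t^(2p). *)
Lemma f_tauE (P : probability 'rV[R]_p R) (f : 'rV[R]_p -> R) t x :
  P `<< leb -> is_density P f -> 0 < t ->
  f_tau P t x = Num.sqrt (lens_mean f f t x).
Proof.
move=> Pac Pf t0; rewrite /f_tau (LLD_rescaled x Pac Pf t0) -/(pair_prod f f t x).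
have tp : 0 < t ^+ p by rewrite exprn_gt0.
have L0 : 0 <= @Lambda1 R p by exact: fine_ge0.
rewrite sqrtrM; last by rewrite mulr_ge0// ltW.
rewrite -expr2 sqrtr_sqr gtr0_norm// invfM mulrACA mulVf ?gt_eqF// mul1r.
by rewrite /lens_mean sqrtrM ?invr_ge0// sqrtrV.
Qed.

End lens_mean.

(** * Passing to the limit of small scales *)

Section small_scale.
Context {R : realType} {p : nat}.
Implicit Types (G D phi : R -> 'rV[R]_p -> R) (x : 'rV[R]_p) (t : R).

Lemma near_slice_r (Q : R * 'rV[R]_p -> Prop) t x :
  (\forall q \near (t, x), Q q) -> \forall y \near x, Q (t, y).
Proof.
move=> nQ; have this : (t, y) @[y --> x] --> (t, x).
  by apply: (@cvg_pair _ _ _ _ (nbhs t) (nbhs x) (nbhs_filter x)); [exact: cvg_cst|exact: cvg_id].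
exact: (this _ nQ).
Qed.

Lemma near_slice_l (Q : R * 'rV[R]_p -> Prop) t x :
  (\forall q \near (t, x), Q q) -> \forall s \near t, Q (s, x).
Proof.
move=> nQ; have this : (s, x) @[s --> t] --> (t, x).
  by apply: (@cvg_pair _ _ _ _ (nbhs t) (nbhs x) (nbhs_filter t)); [exact: cvg_id|exact: cvg_cst].
exact: (this _ nQ).
Qed.

Lemma near_gt0 (T : topologicalType) (u : T -> R) (a : T) :
  {for a, continuous u} -> 0 < u a -> \forall y \near a, 0 < u y.
Proof. by move=> cu u0; apply: cvgr_gt u0; exact: cu. Qed.

(** The argument common to the first and the second derivatives: phi t is
f_t or one of its partial derivatives, and D t x is the formula for its k-th
partial derivative where G > 0.  The formula holds for t > 0, but D is also
defined and continuous at (0, x) when G 0 x > 0, so the limit is D 0 x. *)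
Lemma partial_small_scale G D phi (k : 'I_p) (tau : R) :
  continuous (fun q : R * 'rV[R]_p => G q.1 q.2) ->
  (forall t x, 0 < t -> 0 < G t x -> is_derive x (e_ k) (phi t) (D t x)) ->
  (forall t x, 0 < G t x -> {for (t, x), continuous (fun q => D q.1 q.2)}) ->
  0 < tau ->
  continuous_partial_in [set x | 0 < G tau x] k (phi tau) /\
  forall x, 0 < G 0 x ->
    (\forall t \near 0^'+, derivable (phi t) x (e_ k)) /\
    partial k (phi t) x @[t --> 0^'+] --> D 0 x.
Proof.
move=> cG dphi cD tau0.
have nG t x : 0 < G t x -> \forall q \near (t, x), 0 < G q.1 q.2.
  by move=> G0; apply: (near_gt0 (u := fun q => G q.1 q.2)) => //; exact: cG.
have partialE t x : 0 < t -> 0 < G t x -> partial k (phi t) x = D t x.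
  by move=> t0 G0; case: (dphi t x t0 G0).
split.
  split; first by move=> x G0; case: (dphi tau x tau0 G0).
  apply: continuous_in_subspaceT => x /set_mem /= G0.
  apply: (@cvg_trans _ ((fun y => D tau y) @ x)).
    apply: (near_eq_cvg (FF := nbhs_filter x)).
    apply: filterS (near_slice_r (nG tau x G0)) => y /= Gy.
    by rewrite partialE.
  rewrite partialE//; move=> A /(cD tau x G0); exact: near_slice_r.
move=> x G0.
have nG0 : \forall t \near 0^'+, 0 < G t x.
  by apply: cvg_within; exact: near_slice_l (nG 0 x G0).
split.
  near=> t; have t0 : 0 < t by [].
  have Gt : 0 < G t x by near: t.
  by case: (dphi t x t0 Gt).
apply: (@cvg_trans _ ((fun t => D t x) @ 0^'+)).
  by apply: near_eq_cvg; near=> t; rewrite partialE//; near: t.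
apply: cvg_at_right_filter => A /(cD 0 x G0); exact: near_slice_l.
Unshelve. all: by end_near. Qed.

End small_scale.

Theorem theorem3p1 (R : realType) (p : nat) (hp : (1 <= p)%N)
    (P : probability 'rV[R]_p R) (f : 'rV[R]_p -> R)
    (Pac : P `<< lebesgue_rV p) (Pf : is_density P f)
    (tau : R) (tau_gt0 : 0 < tau)
    (f_C1 : forall j : 'I_p, continuous_partial_in setT j f) :
  (forall j : 'I_p,
     continuous_partial_in (pos_support (f_tau P tau)) j (f_tau P tau) /\
     forall x, pos_support f x ->
       (\forall t \near 0^'+, derivable (f_tau P t) x (e_ j)) /\
       partial j (f_tau P t) x @[t --> 0^'+] --> partial j f x) /\
  ((forall i j : 'I_p, continuous_partial_in setT i (partial j f)) ->
   forall i j : 'I_p,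
     continuous_partial_in (pos_support (f_tau P tau)) i
       (partial j (f_tau P tau)) /\
     forall x, pos_support f x ->
       (\forall t \near 0^'+, derivable (partial j (f_tau P t)) x (e_ i)) /\
       partial i (partial j (f_tau P t)) x @[t --> 0^'+]
         --> partial i (partial j f) x).
Proof.
have [mf f0 _] := Pf.
have C1 (g : 'rV[R]_p -> R) : measurable_fun setT g ->
    (forall j, continuous_partial_in setT j g) ->
    [/\ regular g, forall j x, derivable g x (e_ j) & forall j, regular (partial j g)].
  move=> mg g1; have dg j x : derivable g x (e_ j) by apply: (g1 j).1.
  have cdg j : continuous (partial j g) by apply/continuous_subspace_setT; exact: (g1 j).2.
  split => //; first by split => //; exact: continuous_of_partials.
  by move=> j; split => //; apply: measurable_partial.
have [rf df rdf] := C1 f mf f_C1.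
(* A j is the j-th partial derivative of G = M f f, and D1 j that of sqrt G. *)
pose M (g h : 'rV[R]_p -> R) t x : R := lens_mean g h t x.
pose G := M f f.
pose A j t x := M (partial j f) f t x + M f (partial j f) t x.
pose half_rsqrt (w : R) := (2 * Num.sqrt w)^-1.
pose half_rsqrt1 (w : R) := - (4 * w * Num.sqrt w)^-1.
pose D1 j t x := half_rsqrt (G t x) * A j t x.
have cM g h : regular g -> regular h -> continuous (fun q : R * 'rV[R]_p => M g h q.1 q.2).
  exact: continuous_lens_mean.
have cG : continuous (fun q : R * 'rV[R]_p => G q.1 q.2) by exact: cM.
have cA j : continuous (fun q : R * 'rV[R]_p => A j q.1 q.2).
  by move=> q; apply: cvgD; apply: cM.
have cGc (F : R -> R) t x : {for G t x, continuous F} ->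
    {for (t, x), continuous (fun q : R * 'rV[R]_p => F (G q.1 q.2))}.
  by move=> cF; apply: (@continuous_comp _ _ _ (fun q => G q.1 q.2) F); [exact: cG|exact: cF].
have dG j t x : is_derive x (e_ j) (G t) (A j t x).
  by apply: is_derive_lens_mean.
have fE t : 0 < t -> f_tau P t = (fun x => Num.sqrt (G t x)).
  by move=> t0; apply/funext => x; rewrite (f_tauE x Pac Pf t0).
have G0E x : G 0 x = f x * f x by exact: lens_mean0.
have A0E j x : A j 0 x = partial j f x * f x + f x * partial j f x.
  by rewrite /A /M !lens_mean0.
have sqrtG0 x : Num.sqrt (G 0 x) = f x by rewrite G0E -expr2 sqrtr_sqr ger0_norm.
have d1 j t x : 0 < t -> 0 < G t x -> is_derive x (e_ j) (f_tau P t) (D1 j t x).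
  move=> t0 Gt; rewrite fE//.
  exact: (is_derive_chain (is_derive1_sqrt Gt) (dG j t x)).
have suppE : pos_support (f_tau P tau) = [set x | 0 < G tau x].
  by apply/seteqP; split => x /=; rewrite /pos_support /= fE// sqrtr_gt0.
have supp0 x : pos_support f x -> 0 < G 0 x.
  by rewrite /pos_support /= => fx; rewrite G0E mulr_gt0.
rewrite suppE; split => [j|f_C2 i j].
  have cD1 t x : 0 < G t x -> {for (t, x), continuous (fun q : R * 'rV[R]_p => D1 j q.1 q.2)}.
    move=> Gt; apply: cvgM; last exact: cA.
    by apply: (cGc half_rsqrt); exact: continuous_half_rsqrt.
  have [S1 S2] := partial_small_scale cG (d1 j) cD1 tau_gt0.
  split => // x fx; have := S2 x (supp0 x fx).
  rewrite (_ : D1 j 0 x = partial j f x)// /D1 A0E /half_rsqrt sqrtG0.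
  by field; rewrite gt_eqF.
have ddf k l x : derivable (partial k f) x (e_ l).
  by have [_ + _] := C1 (partial k f) (rdf k).1 (fun l => f_C2 l k); exact.
have rddf k l : regular (partial l (partial k f)).
  by have [_ _] := C1 (partial k f) (rdf k).1 (fun l => f_C2 l k); exact.
(* B is the i-th partial derivative of A j, and D2 that of D1 j. *)
pose B t x := (M (partial i (partial j f)) f t x + M (partial j f) (partial i f) t x) +
  (M (partial i f) (partial j f) t x + M f (partial i (partial j f)) t x).
pose D2 t x := half_rsqrt (G t x) *: B t x + A j t x *: (half_rsqrt1 (G t x) * A i t x).
have dA t x : is_derive x (e_ i) (A j t) (B t x).
  exact: (is_deriveD (is_derive_lens_mean t x (rdf j) rf (rddf j i) (rdf i) (ddf j i) (df i))
    (is_derive_lens_mean t x rf (rdf j) (rdf i) (rddf j i) (df i) (ddf j i))).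
have nGpos t x : 0 < G t x -> \forall y \near x, 0 < G t y.
  move=> Gt; apply: (@near_slice_r _ _ (fun q => 0 < G q.1 q.2)).
  by apply: (near_gt0 (u := fun q => G q.1 q.2)) => //; exact: cG.
have d2 t x : 0 < t -> 0 < G t x -> is_derive x (e_ i) (partial j (f_tau P t)) (D2 t x).
  move=> t0 Gt.
  apply: (@near_eq_is_derive _ _ _ (D1 j t)).
    near=> y; have Gy : 0 < G t y by near: y; exact: nGpos.
    by case: (d1 j t y t0 Gy).
  apply: is_deriveM => //.
  exact: (is_derive_chain (is_derive_half_rsqrt Gt) (dG i t x)).
have cD2 t x : 0 < G t x -> {for (t, x), continuous (fun q : R * 'rV[R]_p => D2 q.1 q.2)}.
  move=> Gt; apply: cvgD; apply: cvgM.
  - by apply: (cGc half_rsqrt); exact: continuous_half_rsqrt.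
  - by apply: cvgD; apply: cvgD; apply: cM.
  - exact: cA.
  - apply: cvgM; last exact: cA.
    by apply: (cGc half_rsqrt1); exact: continuous_derive_half_rsqrt.
have [S1 S2] := partial_small_scale cG d2 cD2 tau_gt0.
split => // x fx; have := S2 x (supp0 x fx).
rewrite (_ : D2 0 x = partial i (partial j f) x)//.
(* At t = 0 the derivatives of f^2 appear: G = f^2, A j = 2 f d_j f and
   B = 2 (f d_i d_j f + d_i f d_j f); the products of first derivatives cancel. *)
rewrite /D2 /B /M !lens_mean0// !A0E /half_rsqrt /half_rsqrt1 sqrtG0 G0E /GRing.scale /=.
by field; rewrite gt_eqF.
Unshelve. all: by end_near. Qed.
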